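(* Let $n\ge 3$. The identity map from the upper-half Euclidean space $(\mathbb{R}^{n}_{+}, ds^2)$ to the hyperbolic space $\mathbb{H}^n = (\mathbb{R}^{n}_{+}, \tilde{h}=\tfrac{1}{(x^{n})^2}ds^2)$ is biharmonic if and only if $n=4$. Furthermore, the biharmonic map (obtained for $n=4$) is not a biharmonic morphism.
   Context: $\mathbb R^n_+=\{(x^1,\dots,x^n)\in\mathbb R^n: x^n>0\}$ and $ds^2$ is the Euclidean metric. For a smooth map $\phi:(M,g)\to(N,h)$ of Riemannian manifolds, $\tau(\phi)=\mathrm{trace}_g\nabla d\phi$ is the tension field, and $\phi$ is biharmonic if $\tau^2(\phi)=-\Delta^\phi\tau(\phi)-\mathrm{trace}_gR^N(d\phi,\tau(\phi))d\phi=0$, with $\Delta^\phi=-\mathrm{trace}_g(\nabla^\phi\nabla^\phi-\nabla^\phi_{\nabla})$ and $R(X,Y)=[\nabla_X,\nabla_Y]-\nabla_{[X,Y]}$. A function $f$ is biharmonic if $\Delta^2f=0$. A continuous map $\phi:(M,g)\to(N,h)$ is a biharmonic morphism if for every biharmonic function $f:U\subset N\to\mathbb R$ ($U$ open) with $\phi^{-1}(U)\ne\emptyset$, the function $f\circ\phi$ is biharmonic on $\phi^{-1}(U)$. *)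

(* Defs.v *)
From mathcomp Require Import all_boot all_order all_algebra.
From mathcomp Require Import all_classical all_reals all_analysis.
From mathcomp Require Import ring.
Import Order.TTheory GRing.Theory Num.Theory.
Import numFieldNormedType.Exports.

Set Implicit Arguments.
Unset Strict Implicit.
Unset Printing Implicit Defensive.

Local Open Scope classical_set_scope.
Local Open Scope ring_scope.

(* Riemannian manifolds covered by one global chart: open subsets of R^n with
   a smooth metric; the tensors below are written in the coordinates of that
   chart. Functions and maps are total on 'rV[R]_n, but at a point of an open set
   U the differential operators depend only on the values on U. *)

Section Smooth.
Context {R : realType}.

Definition partial n (i : 'I_n) (f : 'rV[R]_n -> R) (x : 'rV[R]_n) : R :=
  'D_(delta_mx 0 i) f x.

Definition continuous_on n (U : set 'rV[R]_n) (f : 'rV[R]_n -> R) : Prop :=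
  forall x, U x -> {for x, continuous f}.

Fixpoint Ck_on (k : nat) n (U : set 'rV[R]_n) (f : 'rV[R]_n -> R) : Prop :=
  if k is k'.+1 then
    continuous_on U f /\
    forall i : 'I_n, (forall x, U x -> derivable f x (delta_mx 0 i)) /\
                     Ck_on k' U (partial i f)
  else continuous_on U f.

Definition smooth_on n (U : set 'rV[R]_n) (f : 'rV[R]_n -> R) : Prop :=
  forall k, Ck_on k U f.

End Smooth.

Record riemDomain (R : realType) (n : nat) := RiemDomain {
  carrier : set 'rV[R]_n;
  metric : 'rV[R]_n -> 'M[R]_n;
  carrier_open : open carrier;
  metric_smooth : forall i j, smooth_on carrier (fun x => metric x i j);
  metric_sym : forall x, carrier x -> (metric x)^T = metric x;
  metric_pos : forall x, carrier x ->
    forall v : 'rV[R]_n, v != 0 -> 0 < (v *m metric x *m v^T) 0 0 }.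

Section Geometry.
Context {R : realType}.

(* christoffel g k i j is Gamma^k_{ij} of the Levi-Civita connection. *)
Definition christoffel n (g : 'rV[R]_n -> 'M[R]_n) (k i j : 'I_n)
    (x : 'rV[R]_n) : R :=
  2^-1 * \sum_l invmx (g x) k l *
    (partial i (fun y => g y j l) x + partial j (fun y => g y i l) x
     - partial l (fun y => g y i j) x).

Definition laplacian n (g : 'rV[R]_n -> 'M[R]_n) (f : 'rV[R]_n -> R)
    (x : 'rV[R]_n) : R :=
  \sum_i \sum_j invmx (g x) i j *
    (partial i (partial j f) x - \sum_k christoffel g k i j x * partial k f x).

Definition biharmonic_function n (g : 'rV[R]_n -> 'M[R]_n) (U : set 'rV[R]_n)
    (f : 'rV[R]_n -> R) : Prop :=
  smooth_on U f /\ forall x, U x -> laplacian g (laplacian g f) x = 0.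

Definition connection n (g : 'rV[R]_n -> 'M[R]_n) (X Y : 'rV[R]_n -> 'rV[R]_n)
    (x : 'rV[R]_n) : 'rV[R]_n :=
  \row_a \sum_i X x 0 i *
    (partial i (fun y => Y y 0 a) x + \sum_c christoffel g a i c x * Y x 0 c).

Definition lie_bracket n (X Y : 'rV[R]_n -> 'rV[R]_n) (x : 'rV[R]_n) :
    'rV[R]_n :=
  \row_a \sum_i (X x 0 i * partial i (fun y => Y y 0 a) x
                 - Y x 0 i * partial i (fun y => X y 0 a) x).

Definition curvature_op n (g : 'rV[R]_n -> 'M[R]_n)
    (X Y Z : 'rV[R]_n -> 'rV[R]_n) (x : 'rV[R]_n) : 'rV[R]_n :=
  connection g X (connection g Y Z) x - connection g Y (connection g X Z) x
  - connection g (lie_bracket X Y) Z x.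

(* The value of the curvature tensor on tangent vectors at p, which by
   tensoriality may be computed on their constant extensions. *)
Definition curvature n (g : 'rV[R]_n -> 'M[R]_n) (p u v w : 'rV[R]_n) :
    'rV[R]_n :=
  curvature_op g (fun=> u) (fun=> v) (fun=> w) p.

(* dmap phi i is the section dphi(d/dx^i) of the pull-back bundle phi^-1 TN;
   a section V of that bundle is given by its components V x 0 a in the frame
   d/dy^a at phi x. *)
Definition dmap m n (phi : 'rV[R]_m -> 'rV[R]_n) (i : 'I_m) (x : 'rV[R]_m) :
    'rV[R]_n :=
  \row_a partial i (fun y => phi y 0 a) x.

(* The pull-back connection nabla^phi in the direction d/dx^i. *)
Definition pullback_connection m n (h : 'rV[R]_n -> 'M[R]_n)
    (phi : 'rV[R]_m -> 'rV[R]_n) (i : 'I_m) (V : 'rV[R]_m -> 'rV[R]_n)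
    (x : 'rV[R]_m) : 'rV[R]_n :=
  \row_a (partial i (fun y => V y 0 a) x +
          \sum_b \sum_c christoffel h a b c (phi x) * dmap phi i x 0 b
                        * V x 0 c).

(* (nabla dphi)(d/dx^i, d/dx^j) *)
Definition second_fundamental_form m n (g : 'rV[R]_m -> 'M[R]_m)
    (h : 'rV[R]_n -> 'M[R]_n) (phi : 'rV[R]_m -> 'rV[R]_n) (i j : 'I_m)
    (x : 'rV[R]_m) : 'rV[R]_n :=
  pullback_connection h phi i (dmap phi j) x
  - \sum_k christoffel g k i j x *: dmap phi k x.

Definition tension m n (g : 'rV[R]_m -> 'M[R]_m) (h : 'rV[R]_n -> 'M[R]_n)
    (phi : 'rV[R]_m -> 'rV[R]_n) (x : 'rV[R]_m) : 'rV[R]_n :=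
  \sum_i \sum_j invmx (g x) i j *: second_fundamental_form g h phi i j x.

(* Sign convention: Delta^phi = - trace_g (nabla^phi nabla^phi - nabla^phi_nabla). *)
Definition rough_laplacian m n (g : 'rV[R]_m -> 'M[R]_m)
    (h : 'rV[R]_n -> 'M[R]_n) (phi : 'rV[R]_m -> 'rV[R]_n)
    (V : 'rV[R]_m -> 'rV[R]_n) (x : 'rV[R]_m) : 'rV[R]_n :=
  - \sum_i \sum_j invmx (g x) i j *:
      (pullback_connection h phi i (pullback_connection h phi j V) x
       - \sum_k christoffel g k i j x *: pullback_connection h phi k V x).

Definition bitension m n (g : 'rV[R]_m -> 'M[R]_m) (h : 'rV[R]_n -> 'M[R]_n)
    (phi : 'rV[R]_m -> 'rV[R]_n) (x : 'rV[R]_m) : 'rV[R]_n :=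
  - rough_laplacian g h phi (tension g h phi) x
  - \sum_i \sum_j invmx (g x) i j *:
      curvature h (phi x) (dmap phi i x) (tension g h phi x) (dmap phi j x).

Definition smooth_map m n (M : riemDomain R m) (N : riemDomain R n)
    (phi : 'rV[R]_m -> 'rV[R]_n) : Prop :=
  phi @` carrier M `<=` carrier N /\
  forall a, smooth_on (carrier M) (fun x => phi x 0 a).

Definition biharmonic_map m n (M : riemDomain R m) (N : riemDomain R n)
    (phi : 'rV[R]_m -> 'rV[R]_n) : Prop :=
  smooth_map M N phi /\
  forall x, carrier M x -> bitension (metric M) (metric N) phi x = 0.

Definition biharmonic_morphism m n (M : riemDomain R m) (N : riemDomain R n)
    (phi : 'rV[R]_m -> 'rV[R]_n) : Prop :=
  [/\ phi @` carrier M `<=` carrier N,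
      forall x, carrier M x -> {for x, continuous phi} &
      forall (U : set 'rV[R]_n) (f : 'rV[R]_n -> R),
        open U -> U `<=` carrier N ->
        carrier M `&` phi @^-1` U !=set0 ->
        biharmonic_function (metric N) U f ->
        biharmonic_function (metric M) (carrier M `&` phi @^-1` U) (f \o phi)].

End Geometry.

Section HalfSpace.
Context {R : realType} (n : nat).

(* The ambient dimension is n.+1, so that the last coordinate always exists. *)
Definition half_space : set 'rV[R]_n.+1 := [set x | 0 < x 0 ord_max].

Lemma open_half_space : open half_space.
Proof.
have -> : half_space = (fun x : 'rV[R]_n.+1 => x 0 ord_max) @^-1` [set y | 0 < y].
  by [].
apply: open_comp; last exact: open_gt.
by move=> x _; exact: coord_continuous.
Qed.

Lemma is_derive_last (x v : 'rV[R]_n.+1) :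
  is_derive x v (fun y : 'rV[R]_n.+1 => y 0 ord_max) (v 0 ord_max).
Proof.
have df : differentiable (fun y : 'rV[R]_n.+1 => y 0 ord_max) x.
  exact: differentiable_coord.
apply: DeriveDef; first exact: diff_derivable.
apply: cvg_lim => //; apply/cvg_ballP => e e0.
near=> h.
have h0 : h != 0 by near: h; exact: nbhs_dnbhs_neq.
rewrite /= !mxE addrK /GRing.scale /= mulrA mulVf// mul1r.
exact: ballxx.
Unshelve. all: by end_near. Qed.

Lemma smooth_on_last (c : R) (p : nat) (f : 'rV[R]_n.+1 -> R) :
  (forall x, half_space x -> f x = c * (x 0 ord_max)^-1 ^+ p) ->
  smooth_on half_space f.
Proof.
move=> fE k.
have eqf c0 p0 (f0 : 'rV[R]_n.+1 -> R) x :
    (forall x, half_space x -> f0 x = c0 * (x 0 ord_max)^-1 ^+ p0) ->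
    half_space x ->
    \near x, (c0 \*: ((fun y : 'rV[R]_n.+1 => (y 0 ord_max)^-1) ^+ p0)) x = f0 x.
  move=> f0E hx; have : nbhs x half_space.
    by apply: open_nbhs_nbhs; split => //; exact: open_half_space.
  by apply: filterS => y /f0E ->; rewrite /= fctE.
have cont c0 p0 (f0 : 'rV[R]_n.+1 -> R) :
    (forall x, half_space x -> f0 x = c0 * (x 0 ord_max)^-1 ^+ p0) ->
    continuous_on half_space f0.
  move=> f0E x hx; rewrite /prop_for /continuous_at (f0E x hx).
  apply: cvg_trans; first exact: near_eq_cvg (eqf _ _ _ _ f0E hx).
  rewrite (_ : _ \*: _ = (fun y : 'rV[R]_n.+1 => c0 * (y 0 ord_max)^-1 ^+ p0)).
    apply: cvgMl_tmp.
    apply: (@cvg_comp _ _ _ (fun y : 'rV[R]_n.+1 => (y 0 ord_max)^-1)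
              (@GRing.exp R ^~ p0)); last exact: exprn_continuous.
    by apply: cvgV; [rewrite gt_eqF | exact: coord_continuous].
  by apply/funext => y; rewrite /= fctE.
have der c0 p0 (f0 : 'rV[R]_n.+1 -> R) x v :
    (forall x, half_space x -> f0 x = c0 * (x 0 ord_max)^-1 ^+ p0) ->
    half_space x ->
    is_derive x v f0 (- (c0 * p0%:R * v 0 ord_max) * (x 0 ord_max)^-1 ^+ p0.+1).
  move=> f0E hx; apply: (near_eq_is_derive (eqf _ _ _ _ f0E hx)).
  have x0 : x 0 ord_max != 0 by rewrite gt_eqF.
  have [dl el] := is_derive_last x v.
  have dV : is_derive x v (fun y : 'rV[R]_n.+1 => (y 0 ord_max)^-1)
      (- (x 0 ord_max) ^- 2 *: v 0 ord_max).
    by apply: DeriveDef; [exact: derivableV | rewrite deriveV// el].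
  apply: is_derive_eq; rewrite /GRing.scale /=.
  case: p0 {f0E} => [|p0]; first by rewrite !(mulr0, mul0r, oppr0).
  by rewrite /= -!exprVn !exprS expr0 mulr1; ring.
elim: k c p f fE => [|k IHk] c p f fE; first exact: cont fE.
split; first exact: cont fE.
move=> i; split=> [x hx|]; first by have [] := der _ _ _ x (delta_mx 0 i) fE hx.
apply: (IHk (- (c * p%:R * (delta_mx 0 i : 'rV[R]_n.+1) 0 ord_max)) p.+1) => x hx.
by have [_ <-] := der _ _ _ x (delta_mx 0 i) fE hx.
Qed.

Definition euclidean_metric (x : 'rV[R]_n.+1) : 'M[R]_n.+1 := 1%:M.

Definition hyperbolic_metric (x : 'rV[R]_n.+1) : 'M[R]_n.+1 :=
  ((x 0 ord_max ^+ 2)^-1)%:M.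

Lemma scalar_mx_pos (a : R) (v : 'rV[R]_n.+1) :
  0 < a -> v != 0 -> 0 < (v *m a%:M *m v^T) 0 0.
Proof.
move=> a0 v0; rewrite mul_mx_scalar -scalemxAl mxE pmulr_rgt0// mxE.
have [j vj] : exists j, v 0 j != 0.
  apply/existsP; rewrite -negb_forall; apply: contra v0 => /forallP v0.
  by apply/eqP/rowP => j; rewrite mxE; exact/eqP.
rewrite (bigD1 j)//= ltr_wpDr//; last by rewrite mxE -expr2 exprn_even_gt0.
by apply: sumr_ge0 => l _; rewrite mxE -expr2 sqr_ge0.
Qed.

Lemma smooth_euclidean_metric i j :
  smooth_on half_space (fun x => euclidean_metric x i j).
Proof.
apply: (@smooth_on_last (i == j)%:R 0) => x _.
by rewrite mxE expr0 mulr1.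
Qed.

Lemma smooth_hyperbolic_metric i j :
  smooth_on half_space (fun x => hyperbolic_metric x i j).
Proof.
apply: (@smooth_on_last (i == j)%:R 2) => x _.
by rewrite mxE exprVn mulr_natl.
Qed.

Definition euclidean_half_space : riemDomain R n.+1 :=
  @RiemDomain R n.+1 half_space euclidean_metric open_half_space
    smooth_euclidean_metric
    (fun x _ => tr_scalar_mx _ _)
    (fun x _ v => scalar_mx_pos ltr01).

Lemma hyperbolic_metric_pos x : half_space x ->
  forall v : 'rV[R]_n.+1, v != 0 -> 0 < (v *m hyperbolic_metric x *m v^T) 0 0.
Proof. by move=> x0 v; apply: scalar_mx_pos; rewrite invr_gt0 exprn_gt0. Qed.

Definition hyperbolic_space : riemDomain R n.+1 :=
  @RiemDomain R n.+1 half_space hyperbolic_metric open_half_space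
    smooth_hyperbolic_metric
    (fun x _ => tr_scalar_mx _ _)
    hyperbolic_metric_pos.

End HalfSpace.

Arguments euclidean_half_space : clear implicits.
Arguments hyperbolic_space : clear implicits.

(* Main.v *)
(* Write N for the last index and t for the last coordinate. Every field that
   occurs has constant coefficients times a power of 1/t, and the hyperbolic
   connection acts on those by a closed formula. With dimension n + 1, it gives
   the tension field (n - 1) t^-1 e_N, and, as the curvature is constant -1, the
   bitension field 2 (n - 1) (3 - n) t^-3 e_N, which vanishes for n >= 2 exactly
   when n = 3.
   In any dimension the hyperbolic Laplacian of ln t is the constant -n, so ln t
   is biharmonic on H^(n+1), while its Euclidean bilaplacian is -6 t^-4. *)
Require Import Defs.
From mathcomp Require Import all_boot all_order all_algebra.
From mathcomp Require Import all_classical all_reals all_analysis.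
From mathcomp Require Import ring.
Import Order.TTheory GRing.Theory Num.Theory.
Import numFieldNormedType.Exports.

Set Implicit Arguments.
Unset Strict Implicit.
Unset Printing Implicit Defensive.

(** * Kronecker sums, the Euclidean product, and derivatives of functions of one coordinate *)

Section Calculus.
Local Open Scope classical_set_scope.
Local Open Scope ring_scope.
Context {R : realType} (m : nat).
Implicit Types (x u v w : 'rV[R]_m) (a i j : 'I_m).

Lemma sum_delta i (F : 'I_m -> R) : \sum_j (i == j)%:R * F j = F i.
Proof.
rewrite (bigD1 i)//= eqxx mul1r big1 ?addr0// => j ji.
by rewrite eq_sym (negPf ji) mul0r.
Qed.

Lemma sum_delta_mx (F : 'I_m -> R) :
  \sum_i F i *: delta_mx 0 i = \row_i F i :> 'rV[R]_m.
Proof.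
by rewrite [RHS]row_sum_delta; apply: eq_bigr => i _; rewrite mxE.
Qed.

Definition dot u v : R := \sum_i u 0 i * v 0 i.

Lemma dotC u v : dot u v = dot v u.
Proof. by apply: eq_bigr => i _; rewrite mulrC. Qed.

Lemma dotBr u v w : dot u (v - w) = dot u v - dot u w.
Proof. by rewrite /dot -sumrB; apply: eq_bigr => i _; rewrite !mxE mulrBr. Qed.

Lemma dotZr u v c : dot u (c *: v) = c * dot u v.
Proof.
by rewrite /dot mulr_sumr; apply: eq_bigr => i _; rewrite mxE mulrCA.
Qed.

Lemma dot_delta u i : dot u (delta_mx 0 i) = u 0 i.
Proof.
rewrite -(sum_delta i (fun j => u 0 j)); apply: eq_bigr => j _.
by rewrite mxE eqxx/= mulrC eq_sym.
Qed.

Lemma is_derive_invX (p : nat) (t : R) : t != 0 ->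
  is_derive t 1 (fun s : R => s^-1 ^+ p) (- (p%:R * t^-1 ^+ p.+1)).
Proof.
move=> t0.
have dV : is_derive t 1 (fun s : R => s^-1) (- t ^- 2 *: 1).
  apply: DeriveDef; first exact: derivableV.
  by rewrite deriveV// derive_id.
rewrite (_ : (fun s : R => s^-1 ^+ p) = (fun s : R => s^-1) ^+ p); last first.
  by apply/funext => s; rewrite fctE.
apply: is_derive_eq; rewrite /GRing.scale /=.
(* The power rule produces the exponent [p.-1]; at [p = 0] both sides vanish. *)
case: p => [|p]; first by rewrite !(mulr0, mul0r, oppr0).
by rewrite /= -!exprVn !exprS expr0 mulr1; ring.
Qed.

(* The difference quotient along v only involves f (h * v_a + x_a). *)
Lemma is_derive_comp_coord (f : R -> R) (df : R) a x v :
  is_derive (x 0 a) 1 f df ->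
  is_derive x v (fun y : 'rV[R]_m => f (y 0 a)) (v 0 a * df).
Proof.
move=> [dvf fE].
have dif : differentiable f (x 0 a) by exact/derivable1_diffP.
have qE : (fun h : R => h^-1 *: (f ((h *: v + x) 0 a) - f (x 0 a))) =
          (fun h => h^-1 *: (f (h *: v 0 a + x 0 a) - f (x 0 a))).
  by apply/funext => h; rewrite !mxE.
apply: DeriveDef.
  by rewrite /derivable /= qE; exact: diff_derivable.
rewrite /derive /= qE -[LHS]/('D_(v 0 a) f (x 0 a)) deriveE//.
by rewrite -fE deriveE// -[X in 'd f _ X]mulr1 linearZ.
Qed.

Lemma partial_comp_coord (f : R -> R) (df : R) a i x :
  is_derive (x 0 a) 1 f df ->
  partial i (fun y : 'rV[R]_m => f (y 0 a)) x = (i == a)%:R * df.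
Proof.
move=> df'; have [_] := @is_derive_comp_coord _ _ _ _ (delta_mx 0 i) df'.
by rewrite mxE eqxx/= [a == i]eq_sym.
Qed.

Lemma partial_coord a i x :
  partial i (fun y : 'rV[R]_m => y 0 a) x = (i == a)%:R.
Proof.
by rewrite (@partial_comp_coord id 1) ?mulr1//; exact: is_derive_id.
Qed.

Lemma partial_cst (c : R) i x :
  partial i (fun=> c) x = 0.
Proof. exact: derive_cst. Qed.

(** A derivative depends only on the germ at [x]; this allows differentiating formulas that hold
    only at positive height. *)
Lemma eq_partial (U : set 'rV[R]_m) (f g : 'rV[R]_m -> R) i x :
  open U -> (forall y, U y -> f y = g y) -> U x ->
  partial i f x = partial i g x.
Proof.
move=> oU fg Ux; apply: near_eq_derive.
have : nbhs x U by exact: open_nbhs_nbhs.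
by apply: filterS => y /fg.
Qed.

End Calculus.

(** * Connection and curvature of the hyperbolic metric *)

Section HalfSpaceGeometry.
Local Open Scope classical_set_scope.
Local Open Scope ring_scope.
Context {R : realType} (n : nat).
Implicit Types (x u v w : 'rV[R]_n.+1) (i j k : 'I_n.+1).

Local Notation N := (@ord_max n).
Local Notation H := (@half_space R n).
Local Notation E := (@euclidean_metric R n).
Local Notation h := (@hyperbolic_metric R n).

(** Functions c t^-p on the half-space are stable under partial derivatives, so iterating this rule
    gives all higher ones. *)
Lemma partial_height_invX (f : 'rV[R]_n.+1 -> R) c p i x :
  (forall y, H y -> f y = c * (y 0 N)^-1 ^+ p) -> H x ->
  partial i f x = - (c * p%:R * (i == N)%:R) * (x 0 N)^-1 ^+ p.+1.
Proof.
move=> fE Hx; rewrite (eq_partial i (@open_half_space _ _) fE Hx).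
have x0 : x 0 N != 0 by rewrite gt_eqF.
have dX := is_derive_invX p x0.
rewrite (@partial_comp_coord _ _ (fun s : R => c * s^-1 ^+ p)
  (c * - (p%:R * (x 0 N)^-1 ^+ p.+1))); first by ring.
Qed.

Lemma christoffel_euclidean k i j x :
  christoffel E k i j x = 0.
Proof.
rewrite /christoffel big1 ?mulr0// => l _.
by rewrite !partial_cst subr0 addr0 mulr0.
Qed.

(** The metric is diagonal, so only [l = k] survives; the factor t^2 of the inverse metric and the
    1/2 turn the derivative -2 t^-3 of t^-2 into -t^-1. *)
Lemma christoffel_hyperbolic k i j x : H x ->
  christoffel h k i j x =
  - (x 0 N)^-1 * ((i == N)%:R * (j == k)%:R + (j == N)%:R * (i == k)%:R
                  - (k == N)%:R * (i == j)%:R).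
Proof.
move=> Hx; have x0 : x 0 N != 0 by rewrite gt_eqF.
have dh i' a b : partial i' (fun y => h y a b) x =
    - ((a == b)%:R * 2 * (i' == N)%:R) * (x 0 N)^-1 ^+ 3.
  apply: partial_height_invX => // y _.
  by rewrite mxE exprVn mulr_natl.
rewrite /christoffel invmx_scalar invrK (bigD1 k)//= big1 ?addr0.
  by rewrite mxE eqxx mulr1n !dh; field.
by move=> l lk; rewrite mxE eq_sym (negPf lk) mulr0n mul0r.
Qed.

(** In the coefficient p + 1, p comes from differentiating t^-p and 1 from the Christoffel symbols.
    For constant [X] the result is again a constant vector times a power of 1/t, so the formula can
    be iterated. *)
Lemma connection_hyperbolic (X V : 'rV[R]_n.+1 -> 'rV[R]_n.+1) w p x :
  (forall y, H y -> V y = (y 0 N)^-1 ^+ p *: w) -> H x ->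
  connection h X V x =
  (x 0 N)^-1 ^+ p.+1 *:
    (dot (X x) w *: delta_mx 0 N - w 0 N *: X x - (p.+1%:R * X x 0 N) *: w).
Proof.
move=> VE Hx; apply/rowP => a; rewrite !mxE /=; set t := (x 0 N)^-1.
rewrite (eq_bigr (fun i => (N == i)%:R * - (X x 0 i * (p.+1%:R * w 0 a))
    * t ^+ p.+1 + ((a == i)%:R * - (X x 0 i * w 0 N) * t ^+ p.+1
    + t ^+ p.+1 * (a == N)%:R * (X x 0 i * w 0 i)))).
  rewrite !big_split/= -mulr_sumr -!mulr_suml !sum_delta -/(dot _ _).
  ring.
move=> i _; rewrite (@partial_height_invX _ (w 0 a) p)//; last first.
  by move=> y Hy; rewrite VE// mxE mulrC.
have -> : \sum_c christoffel h a i c x * V x 0 c = - t ^+ p.+1 *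
    ((i == N)%:R * w 0 a + (i == a)%:R * w 0 N - (a == N)%:R * w 0 i).
  rewrite (eq_bigr (fun c => - t ^+ p.+1 * ((a == c)%:R * ((i == N)%:R * w 0 c)
    + (N == c)%:R * ((i == a)%:R * w 0 c)
    - (i == c)%:R * ((a == N)%:R * w 0 c)))).
    by rewrite -mulr_sumr sumrB big_split/= !sum_delta.
  move=> c _; rewrite christoffel_hyperbolic// VE// mxE -/t.
  by rewrite [c == a]eq_sym [c == N]eq_sym exprS; ring.
by rewrite -/t -(natr1 p) [N == i]eq_sym [a == i]eq_sym; ring.
Qed.

(** This is constant curvature -1, since t^-2 [dot] is the hyperbolic inner product. It follows by
    applying the connection formula twice to constant fields, with p = 0 and then p = 1. *)
Lemma curvature_hyperbolic u v w x : H x ->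
  curvature h x u v w = (x 0 N)^-1 ^+ 2 *: (dot u w *: v - dot v w *: u).
Proof.
move=> Hx; rewrite /curvature /curvature_op.
have cst (X : 'rV[R]_n.+1 -> 'rV[R]_n.+1) y : H y ->
    connection h X (fun=> w) y = (y 0 N)^-1 ^+ 1 *:
      (dot (X y) w *: delta_mx 0 N - w 0 N *: X y - (1 * X y 0 N) *: w).
  move=> Hy; rewrite (@connection_hyperbolic _ _ w 0)// => z _.
  by rewrite expr0 scale1r.
(* Constant fields commute, and the connection sees its first argument only through its value at
   [x]. *)
have -> : connection h (lie_bracket (fun=> u) (fun=> v)) (fun=> w) x = 0.
  have l0 : lie_bracket (fun=> u) (fun=> v) x = 0.
    apply/rowP => a; rewrite !mxE big1// => i _.
    by rewrite !partial_cst !mulr0 subr0.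
  by rewrite cst// l0 [dot _ _]dotC -(scale0r w) dotZr !mxE
    !(scale0r, scaler0, mul0r, mulr0, subr0).
rewrite (connection_hyperbolic _ (cst (fun=> v)) Hx).
rewrite (connection_hyperbolic _ (cst (fun=> u)) Hx) subr0.
rewrite !(dotBr, dotZr, dot_delta) (dotC v u).
by apply/rowP => a; rewrite !mxE !eqxx/=; ring.
Qed.

(** * Tension and bitension fields of the identity *)

Lemma dmap_id i x : dmap (@idfun 'rV[R]_n.+1) i x = delta_mx 0 i.
Proof. by apply/rowP => a; rewrite !mxE partial_coord eqxx eq_sym. Qed.

Lemma pullback_connection_id (g : 'rV[R]_n.+1 -> 'M[R]_n.+1) i V x :
  pullback_connection g id i V x = connection g (fun=> delta_mx 0 i) V x.
Proof.
apply/rowP => a; rewrite !mxE [RHS](bigD1 i)//=.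
rewrite [X in _ = _ + X]big1 ?addr0; last first.
  by move=> j ji; rewrite mxE (negPf ji) andbF mul0r.
rewrite mxE !eqxx mul1r; congr +%R; rewrite exchange_big; apply: eq_bigr => c _.
rewrite (bigD1 i)//= big1 ?addr0; last first.
  by move=> j ji; rewrite dmap_id mxE (negPf ji) andbF mulr0 mul0r.
by rewrite dmap_id mxE !eqxx mulr1.
Qed.

Lemma pullback_connection_hyperbolic i V w p x :
  (forall y, H y -> V y = (y 0 N)^-1 ^+ p *: w) -> H x ->
  pullback_connection h id i V x = (x 0 N)^-1 ^+ p.+1 *:
    (w 0 i *: delta_mx 0 N - w 0 N *: delta_mx 0 i
     - (p.+1%:R * (i == N)%:R) *: w).
Proof.
move=> VE Hx; rewrite pullback_connection_id (connection_hyperbolic _ VE Hx).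
by rewrite dotC dot_delta mxE eqxx [N == i]eq_sym.
Qed.

Lemma trace_euclidean (F : 'I_n.+1 -> 'I_n.+1 -> 'rV[R]_n.+1) x :
  \sum_i \sum_j invmx (E x) i j *: F i j = \sum_i F i i.
Proof.
apply: eq_bigr => i _; rewrite invmx1 (bigD1 i)//= mxE eqxx scale1r.
by rewrite big1 ?addr0// => j ji; rewrite mxE eq_sym (negPf ji) scale0r.
Qed.

Lemma tension_id x : H x ->
  tension E h id x =
  (x 0 N)^-1 *: ((n%:R - 1) *: delta_mx 0 N).
Proof.
move=> Hx; rewrite /tension trace_euclidean.
(* Each of the n + 1 indices contributes t^-1 e_N, and [i = N] also subtracts 2 t^-1 e_N, leaving
   the factor n - 1. *)
rewrite (eq_bigr (fun i => (x 0 N)^-1 *: (delta_mx 0 N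
  - (i == N)%:R *: delta_mx 0 i - (i == N)%:R *: delta_mx 0 i))).
  rewrite -scaler_sumr !sumrB sumr_const card_ord !sum_delta_mx; congr (_ *: _).
  by apply/rowP => a; rewrite -(scaler_nat n.+1) !mxE eqxx -(natr1 n)/=; ring.
move=> i _; rewrite /second_fundamental_form big1 ?subr0; last first.
  by move=> k _; rewrite christoffel_euclidean scale0r.
rewrite (@pullback_connection_hyperbolic _ _ (delta_mx 0 i) 0)//; last first.
  by move=> y _; rewrite dmap_id expr0 scale1r.
by rewrite !mxE !eqxx/= scale1r mul1r [N == i]eq_sym expr1.
Qed.

Lemma rough_laplacian_tension x : H x ->
  rough_laplacian E h id (tension E h id) x =
  - (x 0 N)^-1 ^+ 3 *: ((n%:R - 1) * (6 - n%:R) *: delta_mx 0 N).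
Proof.
move=> Hx; rewrite /rough_laplacian trace_euclidean scaleNr; congr (- _).
pose c : R := n%:R - 1.
(* Up to the factor c t^-3, every index gives -e_N and [i = N] adds (5 + 2) e_N, so the sum is 7 -
   (n + 1) = 6 - n. *)
rewrite (eq_bigr (fun i => (x 0 N)^-1 ^+ 3 *: (c *:
    ((i == N)%:R *: (5 *: delta_mx 0 i + 2 *: delta_mx 0 N) - delta_mx 0 N)))).
  rewrite -!scaler_sumr sumrB sumr_const card_ord (bigD1 N)//= big1 ?addr0.
    apply/rowP => a; rewrite -(scaler_nat n.+1) !mxE !eqxx -(natr1 n)/= /c.
    ring.
  by move=> i /negPf ->; rewrite scale0r.
move=> i _; rewrite big1 ?subr0; last first.
  by move=> k _; rewrite christoffel_euclidean scale0r.
(* The first covariant derivative of c t^-1 e_N along e_i is t^-2 times this vector, hence exponent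
   2 for the second one. *)
rewrite (@pullback_connection_hyperbolic _ _
  (- c *: (delta_mx 0 i + (i == N)%:R *: delta_mx 0 N)) 2)//; last first.
  move=> y Hy.
  rewrite (@pullback_connection_hyperbolic _ _ (c *: delta_mx 0 N) 1)//.
    by apply/rowP => a; rewrite !mxE !eqxx/=; ring.
  by move=> z Hz; rewrite tension_id// expr1.
apply/rowP => a; rewrite !mxE !eqxx/= [N == i]eq_sym.
by case: (i == N); rewrite /=; ring.
Qed.

(** The curvature trace equals n (n - 1) t^-3 e_N; subtracting it turns the factor 6 - n of the
    connection term into 6 - 2n = 2 (3 - n). *)
Lemma bitension_id x : H x ->
  bitension E h id x =
  (x 0 N)^-1 ^+ 3 *: (2 * (n%:R - 1) * (3 - n%:R) *: delta_mx 0 N).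
Proof.
move=> Hx; rewrite /bitension rough_laplacian_tension// trace_euclidean.
pose c : R := n%:R - 1.
have x0 : x 0 N != 0 by rewrite gt_eqF.
rewrite (eq_bigr (fun i => (x 0 N)^-1 ^+ 3 *: (c *:
   (delta_mx 0 N - (i == N)%:R *: delta_mx 0 i)))); last first.
  move=> i _; rewrite curvature_hyperbolic// !dmap_id tension_id// !dot_delta.
  by apply/rowP => a; rewrite !mxE !eqxx/= mulr1n /c; field.
rewrite -!scaler_sumr sumrB sumr_const card_ord sum_delta_mx.
by apply/rowP => a; rewrite -(scaler_nat n.+1) !mxE eqxx -(natr1 n)/= /c; ring.
Qed.

Lemma smooth_coord a : smooth_on H (fun x => x 0 a).
Proof.
case=> [|k] /=; first by move=> x _; exact: coord_continuous.
split=> [x _|i]; first exact: coord_continuous.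
split=> [x _|]; first exact/diff_derivable/differentiable_coord.
(* After one differentiation the function is constant, the case p = 0 of c t^-p. *)
apply: (smooth_on_last (c := (i == a)%:R) (p := 0)) => x _.
by rewrite partial_coord mulr1.
Qed.

Lemma biharmonic_id : (1 < n)%N ->
  biharmonic_map (euclidean_half_space R n) (hyperbolic_space R n) id <-> n = 3%N.
Proof.
move=> n1; split=> [[_ /= b]|n3]; last first.
  split; first by split=> [_ [x Hx <-]//|a]; exact: smooth_coord.
  move=> x Hx; rewrite /= bitension_id// (_ : n%:R = 3) ?n3//.
  by rewrite subrr mulr0 scale0r scaler0.
(* At a point of height 1 the powers of 1/t disappear, and the last component of the bitension field
   is 2 (n - 1) (3 - n); [n1] excludes the root n = 1. *)
have e1 : (const_mx 1 : 'rV[R]_n.+1) 0 N = 1 by rewrite mxE.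
have He : H (const_mx 1) by rewrite /half_space/= e1.
have := b _ He; rewrite bitension_id// e1 invr1 expr1n scale1r.
move=> /rowP/(_ N); rewrite !mxE !eqxx mulr1 => /eqP.
rewrite !mulf_eq0 pnatr_eq0/= !subr_eq0 (eqr_nat _ n 1) (eqr_nat _ 3 n).
by rewrite gtn_eqF//= => /eqP.
Qed.

(** * Laplacians of functions, and the test function ln t *)

Lemma laplacian_euclidean f x :
  laplacian E f x = \sum_i partial i (partial i f) x.
Proof.
have G0 i j : \sum_k christoffel E k i j x * partial k f x = 0.
  by rewrite big1// => k _; rewrite christoffel_euclidean mul0r.
apply: eq_bigr => i _.
rewrite (eq_bigr (fun j => (i == j)%:R * partial i (partial j f) x)).
  exact: sum_delta.
by move=> j _; rewrite G0 subr0 invmx1 mxE.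
Qed.

Lemma laplacian_hyperbolic f x : H x ->
  laplacian h f x = (x 0 N) ^+ 2 * \sum_i partial i (partial i f) x
                    - (n%:R - 1) * x 0 N * partial N f x.
Proof.
move=> Hx; have x0 : x 0 N != 0 by rewrite gt_eqF.
(* The first-order terms sum to t times 2 - (n + 1) = -(n - 1) copies of the last partial
   derivative. *)
rewrite /laplacian (eq_bigr (fun i => x 0 N ^+ 2 * partial i (partial i f) x +
    x 0 N * ((N == i)%:R * (2 * partial i f x) - partial N f x))).
  rewrite big_split/= -!mulr_sumr sumrB sum_delta sumr_const card_ord.
  by rewrite -(mulr_natl _ n.+1) -(natr1 n); ring.
have GE i : \sum_k christoffel h k i i x * partial k f x =
    (x 0 N)^-1 * (partial N f x - (N == i)%:R * (2 * partial i f x)).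
  rewrite (eq_bigr (fun k => - (x 0 N)^-1 *
    ((i == k)%:R * (2 * (i == N)%:R * partial k f x)
     - (N == k)%:R * partial k f x))).
    rewrite -mulr_sumr sumrB !sum_delta [N == i]eq_sym.
    by move: (partial i f x) (partial N f x) => a b; ring.
  by move=> k _; rewrite christoffel_hyperbolic// eqxx/= [k == N]eq_sym; ring.
move=> i _.
rewrite (eq_bigr (fun j => (i == j)%:R * (x 0 N ^+ 2 *
  (partial i (partial j f) x - \sum_k christoffel h k i j x * partial k f x)))).
  rewrite sum_delta GE.
  by move: (partial i _ x) (partial i f x) (partial N f x) => a b c; field.
by move=> j _; rewrite invmx_scalar invrK mxE mulrA mulr_natl.
Qed.

Local Notation lnt := (fun x : 'rV[R]_n.+1 => ln (x 0 N)).

Lemma partial_ln_height i x : H x ->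
  partial i lnt x = (i == N)%:R * (x 0 N)^-1.
Proof. by move=> Hx; apply: partial_comp_coord; exact: is_derive1_ln. Qed.

Lemma smooth_ln_height : smooth_on H lnt.
Proof.
have cln : continuous_on H lnt.
  move=> x Hx.
  apply: (@continuous_comp _ _ _ (fun y : 'rV[R]_n.+1 => y 0 N) (@ln R)).
    exact: coord_continuous.
  exact: continuous_ln.
case=> [//|k] /=; split=> // i; split=> [x Hx|].
  by have [] := is_derive_comp_coord (delta_mx 0 i) (is_derive1_ln Hx).
(* The logarithm itself is not of the form c t^-p, but its first partial derivatives are. *)
apply: (smooth_on_last (c := (i == N)%:R) (p := 1)) => x.
exact: partial_ln_height.
Qed.

Lemma partial2_ln_height i x : H x ->
  partial i (partial i lnt) x = - (i == N)%:R * (x 0 N)^-1 ^+ 2.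
Proof.
move=> Hx; rewrite (@partial_height_invX _ (i == N)%:R 1)//.
  by case: (i == N); rewrite /= ?mulr1 ?mulr0 ?mul0r.
by move=> y; exact: partial_ln_height.
Qed.

Lemma sum_partial2_ln_height x : H x ->
  \sum_i partial i (partial i lnt) x = - (x 0 N)^-1 ^+ 2.
Proof.
move=> Hx; rewrite (bigD1 N)//= big1 => [|i /negPf iN].
  by rewrite partial2_ln_height// eqxx mulN1r addr0.
by rewrite partial2_ln_height// iN oppr0 mul0r.
Qed.

Lemma biharmonic_ln_height : biharmonic_function h H lnt.
Proof.
split=> [|x Hx]; first exact: smooth_ln_height.
(* Here t^2 (-t^-2) - (n - 1) = -n. The constant is written with t^0 so that [partial_height_invX]
   applies to an identity known only on the half-space. *)
have lE y : H y -> laplacian h lnt y = - n%:R * (y 0 N)^-1 ^+ 0.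
  move=> Hy; have y0 : y 0 N != 0 by rewrite gt_eqF.
  rewrite laplacian_hyperbolic// sum_partial2_ln_height// partial_ln_height//.
  by rewrite eqxx expr0/=; field.
have p0 i y : H y -> partial i (laplacian h lnt) y = 0 * (y 0 N)^-1 ^+ 0.
  by move=> Hy; rewrite (partial_height_invX _ lE)// mulr0 !mul0r oppr0 mul0r.
rewrite laplacian_hyperbolic// p0// !mul0r mulr0 subr0 big1 ?mulr0// => i _.
by rewrite (partial_height_invX _ (p0 i))// !mul0r oppr0 mul0r.
Qed.

Lemma bilaplacian_euclidean_ln_height x : H x ->
  laplacian E (laplacian E lnt) x =
  - 6 * (x 0 N)^-1 ^+ 4.
Proof.
move=> Hx.
have lE y : H y -> laplacian E lnt y = - 1 * (y 0 N)^-1 ^+ 2.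
  by move=> Hy; rewrite laplacian_euclidean sum_partial2_ln_height// mulN1r.
have p1 i y : H y -> partial i (laplacian E lnt) y =
    (2 * (i == N)%:R) * (y 0 N)^-1 ^+ 3.
  by move=> Hy; rewrite (partial_height_invX _ lE)//; ring.
rewrite laplacian_euclidean (bigD1 N)//= big1 => [|i /negPf iN].
  by rewrite addr0 (partial_height_invX _ (p1 N))// eqxx/=; ring.
by rewrite (partial_height_invX _ (p1 i))// iN/=; ring.
Qed.

(** Composition with the identity leaves ln t unchanged, so it would have to be Euclidean
    biharmonic; its bilaplacian at height 1 is -6. *)
Lemma not_biharmonic_morphism_id :
  ~ biharmonic_morphism (euclidean_half_space R n) (hyperbolic_space R n) id.
Proof.
case=> _ _ /(_ H lnt) mor.
have e1 : (const_mx 1 : 'rV[R]_n.+1) 0 N = 1 by rewrite mxE.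
have He : H (const_mx 1) by rewrite /half_space/= e1.
have [] := mor (@open_half_space _ _) (@subset_refl _ _) _ biharmonic_ln_height.
  by exists (const_mx 1).
move=> _ /(_ (const_mx 1) (conj He He)) /eqP.
rewrite [_ \o _]/= bilaplacian_euclidean_ln_height// e1 invr1 expr1n mulr1.
by rewrite oppr_eq0 pnatr_eq0.
Qed.

End HalfSpaceGeometry.

Theorem proposition3 (R : realType) (n : nat) (hn : (3 <= n.+1)%N) :
  (biharmonic_map (euclidean_half_space R n) (hyperbolic_space R n) id <->
     n.+1 = 4) /\
  (n.+1 = 4 ->
     ~ biharmonic_morphism (euclidean_half_space R n) (hyperbolic_space R n) id).
Proof.
split=> [|_]; last exact: not_biharmonic_morphism_id.
by rewrite biharmonic_id//; split=> [->|[]].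
Qed.
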